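(* Let $(X_{i,j})_{i,j\geq 1}$ be an infinite array of i.i.d. nonnegative real random variables with mean $\mathbb{E}(X_{1,1})=1$ and finite positive variance $0<\sigma^2<\infty$. For each $n\geq 1$, let $M$ be the $n\times n$ random Markov matrix with $M_{i,j}=X_{i,j}/(X_{i,1}+\cdots+X_{i,n})$ (with $M_{i,j}=\delta_{i,j}$ for all $j$ if $X_{i,1}+\cdots+X_{i,n}=0$). Assume that the law of $X_{1,1}$ has a bounded density (with respect to Lebesgue measure). Then for every $a,C>0$ there exists $b>0$ such that for any $z\in\mathbb{C}$ with $|z|\leq C$, for all large enough $n$, $$\mathbb{P}\left(s_n(\sqrt{n}M-zI)\leq n^{-b}\right)\leq n^{-a}.$$ In particular, for every $C>0$ there exists $b>0$ (which may depend on $C$) such that for any $z\in\mathbb{C}$ with $|z|\leq C$, almost surely, for all large enough $n$, the matrix $\sqrt{n}M-zI$ is invertible with $s_n(\sqrt{n}M-zI)\geq n^{-b}$.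
   Context: For an $n\times n$ complex matrix $A$, $s_1(A)\geq\cdots\geq s_n(A)$ denote its singular values, i.e. the eigenvalues of $\sqrt{AA^*}$ in nonincreasing order, where $A^*$ is the conjugate transpose; thus $s_n(A)$ is the smallest singular value. $I$ is the $n\times n$ identity matrix. All random matrices are built from the same infinite array, on a common probability space. *)

(* Defs.v *)
From HB Require Import structures.
From mathcomp Require Import all_boot all_order all_algebra.
From mathcomp Require Import finmap.
From mathcomp Require Import all_classical all_reals all_analysis.
From mathcomp Require Export complex.

Set Implicit Arguments.
Unset Strict Implicit.
Unset Printing Implicit Defensive.

Import Order.TTheory GRing.Theory Num.Theory.
Import numFieldNormedType.Exports.
Local Open Scope ring_scope.

(* Complex matrices have entries in R[i], where conjC is complex conjugation,
   so that A ^t* is the conjugate transpose A^*. *)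
Section SingularValues.
Local Open Scope sesquilinear_scope.

(* The eigenvalues of A, each repeated according to its multiplicity as a root
   of the characteristic polynomial, in an unspecified order. *)
Definition eigenvalues (C : numClosedFieldType) (n : nat) (A : 'M[C]_n) :
  seq C := sval (closed_field_poly_normal (char_poly A)).

(* The square root of a positive semidefinite Hermitian matrix H, by functional
   calculus: if H = U^* diag(d) U with U unitary, take U^* diag(sqrt d) U. *)
Definition sqrtmx (C : numClosedFieldType) (n : nat) (H : 'M[C]_n) : 'M[C]_n :=
  (spectralmx H) ^t* *m diag_mx (map_mx sqrtC (spectral_diag H))
    *m spectralmx H.

(* sqrtmx (A A^* ) is positive semidefinite (sqrtmx_psd below), so its
   eigenvalues are real and taking their real part only changes their type. *)
Definition singular_values (R : realType) (n : nat) (A : 'M[R[i]]_n) : seq R :=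
  sort >=%R [seq complex.Re x | x <- eigenvalues (sqrtmx (A *m A ^t*))].

(* k ranges over 1, ..., n, as in s_1(A) >= ... >= s_n(A). *)
Definition singular_value (R : realType) (n : nat) (k : nat) (A : 'M[R[i]]_n) :
  R := nth 0 (singular_values A) k.-1.

Lemma eigenvaluesE (C : numClosedFieldType) n (A : 'M[C]_n) :
  char_poly A = \prod_(x <- eigenvalues A) ('X - x%:P).
Proof.
rewrite /eigenvalues; case: closed_field_poly_normal => r /= {1}->.
by rewrite (monicP (char_poly_monic A)) scale1r.
Qed.

Lemma size_eigenvalues (C : numClosedFieldType) n (A : 'M[C]_n) :
  size (eigenvalues A) = n.
Proof.
by apply: succn_inj; rewrite -(size_char_poly A) eigenvaluesE size_prod_XsubC.
Qed.

Lemma size_singular_values (R : realType) n (A : 'M[R[i]]_n) :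
  size (singular_values A) = n.
Proof. by rewrite size_sort size_map size_eigenvalues. Qed.

Lemma gram_normalmx (C : numClosedFieldType) n (A : 'M[C]_n) :
  A *m A ^t* \is normalmx.
Proof.
by apply/normalmxP; rewrite trmx_mul map_mxM /= trmxCK.
Qed.

Lemma sqrtmx_sqr (C : numClosedFieldType) n (A : 'M[C]_n) :
  sqrtmx (A *m A ^t*) *m sqrtmx (A *m A ^t*) = A *m A ^t*.
Proof.
have /orthomx_spectralP := gram_normalmx A.
move: (A *m A ^t*) => H HE; rewrite [RHS]HE /sqrtmx.
rewrite -invmx_unitary ?spectral_unitarymx //.
rewrite -!mulmxA (mulmxA (spectralmx H) (invmx _)) mulmxV ?spectral_unit //.
rewrite mul1mx (mulmxA (diag_mx _) (diag_mx _)) mulmx_diag.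
congr (_ *m (diag_mx _ *m _)); apply/rowP => i.
by rewrite !mxE -expr2 sqrtCK.
Qed.

Lemma spectral_diag_gram_ge0 (C : numClosedFieldType) n (A : 'M[C]_n) i :
  0 <= spectral_diag (A *m A ^t*) 0 i.
Proof.
set H := A *m A ^t*; set U := spectralmx H.
have HE : H = invmx U *m diag_mx (spectral_diag H) *m U.
  exact/orthomx_spectralP/gram_normalmx.
have uU : U \is unitarymx := spectral_unitarymx H.
have -> : spectral_diag H 0 i = ((U *m A) *m (U *m A) ^t*) i i.
  rewrite trmx_mul map_mxM /= mulmxA -(mulmxA U) -/H [in X in _ = X]HE.
  rewrite !mulmxA mulmxV ?unitarymx_unit // mul1mx.
  by rewrite -mulmxA (unitarymxP uU) mulmx1 !mxE eqxx mulr1n.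
rewrite [in X in _ <= X]mxE sumr_ge0 // => j _.
by rewrite [(U *m A) ^t* _ _]mxE [(U *m A)^T _ _]mxE mul_conjC_ge0.
Qed.

Lemma sqrtmx_psd (C : numClosedFieldType) n (A : 'M[C]_n) (v : 'rV[C]_n) :
  0 <= (v *m sqrtmx (A *m A ^t*) *m v ^t*) 0 0.
Proof.
rewrite /sqrtmx; set U := spectralmx _.
rewrite !mulmxA -mulmxA.
have -> : U *m v ^t* = (v *m U ^t*) ^t* by rewrite trmx_mul map_mxM /= trmxCK.
set w := v *m _; rewrite mxE sumr_ge0 // => j _.
rewrite mul_mx_diag !mxE mulrAC mulr_ge0 ?mul_conjC_ge0 //.
by rewrite sqrtC_ge0 spectral_diag_gram_ge0.
Qed.

End SingularValues.

Section Probability.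
Local Open Scope classical_set_scope.
Local Open Scope ereal_scope.

Definition mutually_independent (d : measure_display) (T : measurableType d)
    (R : realType) (P : probability T R) (I : choiceType)
    (X : I -> {RV P >-> R}) : Prop :=
  forall (J : {fset I}) (B : I -> set R),
    (forall i, i \in J -> measurable (B i)) ->
    P (\bigcap_(i in [set` J]) (X i @^-1` B i)) =
    \prod_(i <- J) P (X i @^-1` B i).

Definition identically_distributed (d : measure_display) (T : measurableType d)
    (R : realType) (P : probability T R) (I : Type)
    (X : I -> {RV P >-> R}) : Prop :=
  forall (i j : I) (B : set R), measurable B ->
    distribution P (X i) B = distribution P (X j) B.

Definition has_bounded_density (d : measure_display) (T : measurableType d)
    (R : realType) (P : probability T R) (X : {RV P >-> R}) : Prop :=
  exists f : R -> R,
    [/\ measurable_fun setT f,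
        (forall x, (0 <= f x)%R),
        (exists K : R, forall x, (f x <= K)%R) &
        forall B : set R, measurable B ->
          distribution P X B = \int[lebesgue_measure]_(x in B) (f x)%:E].

End Probability.

(* Rows and columns are numbered from 0. *)
Definition markov_mx (R : realType) (X : nat -> nat -> R) (n : nat) : 'M[R]_n :=
  \matrix_(i < n, j < n)
    if \sum_(k < n) X i k == 0 then (i == j)%:R
    else X i j / \sum_(k < n) X i k.

Definition shifted_markov_mx (R : realType) (X : nat -> nat -> R) (n : nat)
    (z : R[i]) : 'M[R[i]]_n :=
  map_mx (real_complex R) (Num.sqrt n%:R *: markov_mx X n) - z%:M.

(* Main.v *)
(* Let A = sqrt n M - z I.  If s_n(A) <= t, there is a unit row vector v with
   |v A| <= t; a coordinate v_i of size at least 1/n then gives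
   |det A| <= t n^2 max_j |cof_ij A|.  Multiplying by the i-th row sum S_i makes
   the expansion of det A along row i linear in that row of X:
   S_i det A = sum_k X_ik y_k with y_k = sqrt n cof_ik A - z cof_ii A, and the y_k
   depend only on the other rows.  For large n, max_k |cof_ik A| is at most
   (1 + |z|) max_k |y_k|, so, dividing by the largest coefficient y_j, X_ij lies
   within O(t n^2 S_i) of a quantity that does not involve X_ij.  The bounded
   density makes this unlikely; Chebyshev's inequality controls S_i, and a union
   bound over (i, j) finishes.  The argument needs det A and the row sums to be
   nonzero almost surely, which the same anticoncentration gives by induction on
   leading principal minors.

   The probability is only meaningful on measurable sets: s_n(A) > t holds iff
   all coefficients of the characteristic polynomial of t^2 I - A A^* are
   positive, which is a measurable condition.  The almost sure statement is
   Borel-Cantelli with a = 2. *)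
Require Import Defs.
From mathcomp Require Import all_boot all_order all_algebra.
From mathcomp Require Import finmap.
From mathcomp Require Import all_classical all_reals all_analysis.
From mathcomp Require Import measurable_realfun.
From mathcomp Require Import ring lra zify.

Import Order.TTheory GRing.Theory Num.Theory.
Import numFieldNormedType.Exports.
Local Open Scope classical_set_scope.
Local Open Scope ring_scope.
Local Open Scope complex_scope.

Set Implicit Arguments.
Unset Strict Implicit.
Unset Printing Implicit Defensive.

(** * Anticoncentration under independence *)

Section Independence.
Context d (T : measurableType d) (R : realType) (P : probability T R).
Context (I : choiceType) (X : I -> {RV P >-> R}).
Hypothesis Xindep : mutually_independent X.
Variable i0 : I.

(* Requiring [B i = setT] off [J] makes the family stable under intersection. *)
Definition cylinders_avoiding : set_system T :=
  [set E | exists (J : {fset I}) (B : I -> set R),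
    [/\ i0 \notin J, forall i, measurable (B i),
        forall i, i \notin J -> B i = setT &
        E = \bigcap_(i in [set` J]) (X i @^-1` B i)]].

Let sigma_avoiding := g_sigma_algebraType cylinders_avoiding.

Lemma cylinders_avoiding_setI : setI_closed cylinders_avoiding.
Proof.
move=> _ _ [J1 [B1 [i01 mB1 B1T ->]]] [J2 [B2 [i02 mB2 B2T ->]]].
exists (J1 `|` J2)%fset, (fun i => B1 i `&` B2 i); split.
- by rewrite in_fsetU negb_or i01.
- by move=> i; exact: measurableI.
- by move=> i; rewrite in_fsetU negb_or => /andP[/B1T-> /B2T->]; rewrite setIT.
apply/seteqP; split => [w [h1 h2] i /=|w h].
  move=> _; split.
    by have [iJ|/B1T->//] := boolP (i \in J1); exact: (h1 i iJ).
  by have [iJ|/B2T->//] := boolP (i \in J2); exact: (h2 i iJ).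
split=> i /= iJ; have := h i; rewrite /= in_fsetU iJ ?orbT => /(_ isT) [] //.
Qed.

Lemma measurable_cylinders_avoiding :
  cylinders_avoiding `<=` (measurable : set_system T).
Proof.
move=> _ [J [B [_ mB _ ->]]].
apply: fin_bigcap_measurable => [|i _]; first exact: finite_fset.
exact: measurable_funPTI.
Qed.

Lemma measurable_sigma_avoiding (E : set T) :
  measurable (E : set sigma_avoiding) -> measurable E.
Proof.
rewrite /measurable/=.
move: E; apply: (@smallest_sub _ _ cylinders_avoiding measurable).
  exact: sigma_algebra_measurable.
exact: measurable_cylinders_avoiding.
Qed.

Lemma measurable_fun_sigma_avoiding (W : T -> R) :
  measurable_fun setT (W : sigma_avoiding -> R) -> measurable_fun setT W.
Proof.
by move=> mW _ B mB; apply: measurable_sigma_avoiding; exact: mW.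
Qed.

Lemma measurable_fun_other (i : I) :
  i != i0 -> measurable_fun setT (X i : sigma_avoiding -> R).
Proof.
move=> ii0 _ B mB; rewrite setTI; apply: sub_gen_smallest.
exists [fset i]%fset, (fun k => if k == i then B else setT); split.
- by rewrite in_fset1 eq_sym.
- by move=> k; case: ifP.
- by move=> k; rewrite in_fset1 => /negbTE ->.
apply/seteqP; split=> [w Bw k /=|w /(_ i)/=].
  by rewrite in_fset1 => /eqP ->; rewrite eqxx.
by rewrite in_fset1 eqxx => /(_ isT).
Qed.

(** Dynkin's argument: for fixed [C], the events [E] obeying the product formula form a Dynkin
    system, and the cylinders avoiding [i0] are a generating family stable under intersection. *)
Lemma indep_sigma_avoiding (C : set R) (E : set T) :
  measurable C -> measurable (E : set sigma_avoiding) ->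
  P (E `&` X i0 @^-1` C) = (P E * P (X i0 @^-1` C))%E.
Proof.
move=> mC; have mXC : measurable (X i0 @^-1` C).
  exact: measurable_funPTI.
have PXC : P (X i0 @^-1` C) \is a fin_num by exact: fin_num_measure.
(* Measurability in [T] is carried through the induction, since the complement and union steps use
   identities for [P] on [T]. *)
move=> mE; suff [] : measurable E /\
  P (E `&` X i0 @^-1` C) = (P E * P (X i0 @^-1` C))%E by [].
move: E mE; apply: (@dynkin_induction _ sigma_avoiding cylinders_avoiding
  (fun E => measurable (E : set T) /\
    P (E `&` X i0 @^-1` C) = (P E * P (X i0 @^-1` C))%E)) => //.
- exact: cylinders_avoiding_setI.
- by split=> //; rewrite setTI probability_setT mul1e.
- move=> E GE; split; first exact: measurable_cylinders_avoiding.
  case: GE => J [B [i0J mB BT ->]].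
  (* Placing [C] at [i0] turns the intersection into a single cylinder over [J] and [i0], to which
     mutual independence applies. *)
  pose B' i := if i == i0 then C else B i.
  have mB' i : measurable (B' i) by rewrite /B'; case: ifP.
  have B'0 : B' i0 = C by rewrite /B' eqxx.
  have BB' i : i \in J -> B' i = B i.
    by move=> iJ; rewrite /B'; case: eqP => // ii; rewrite -ii iJ in i0J.
  have := @Xindep (i0 |` J)%fset B' (fun i _ => mB' i).
  rewrite big_fsetU1//= B'0 muleC.
  rewrite (eq_big_seq (fun i => P (X i @^-1` B i))); last first.
    by move=> i iJ; rewrite BB'.
  rewrite -(@Xindep J B) // => <-; congr (P _).
  apply/seteqP; split=> [w [h1 h2] i /=|w h].
    rewrite in_fset1U => /orP[/eqP ->|iJ]; first by rewrite B'0.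
    by rewrite BB'//; exact: h1.
  split=> [i iJ|].
    by have := h i; rewrite /= in_fset1U iJ orbT BB'// => /(_ isT).
  by have := h i0; rewrite /= in_fset1U eqxx B'0 => /(_ isT).
- move=> S mS [mS' PS]; split; first exact: measurableC.
  have mSC : @measurable _ T (S `&` X i0 @^-1` C) by exact: measurableI.
  rewrite setIC -setDE measureD//; last by rewrite ltey_eq PXC.
  rewrite [X in (_ - P X)%E]setIC PS probability_setC// muleBl//.
    by rewrite mul1e.
- move=> F mF tF PF; split; first by apply: bigcup_measurable => k _; case: (PF k).
  rewrite setI_bigcupl !measure_bigcup//.
  + rewrite -(fineK PXC) muleC -nneseriesZl//.
    by apply: eq_eseriesr => k _; rewrite fineK// muleC; case: (PF k).
  + by move=> k _; case: (PF k).
  + by move=> k _; apply: measurableI => //; case: (PF k).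
  + by apply/trivIsetP => a b _ _ ab; rewrite setIACA (iffLR trivIsetP tF) ?set0I.
Qed.

(** Discretising [W] replaces conditioning on it: on each cell of length [u] the variable [X i0] is
    confined to a fixed interval, independence factors out the probability of the cell, and the
    cells sum to 1. *)
Lemma small_ball_sum (K u : R) (W : T -> R) :
  (forall a b, a <= b -> (P (X i0 @^-1` `[a, b]) <= (K * (b - a))%:E)%E) ->
  measurable_fun setT (W : sigma_avoiding -> R) -> 0 < u ->
  (P [set w | (`|X i0 w + W w| <= u)%R] <= (K * (3 * u))%:E)%E.
Proof.
move=> hK mW u0.
have mW' := measurable_fun_sigma_avoiding mW.
(* The k-th cell of the partition of the line into intervals of length u,
   enumerated by a natural number. *)
pose B n := [set x : R | choice.pickle (Num.floor (x / u)) = n].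
have BE n (k : int) : choice.pickle k = n -> B n = `[k%:~R * u, (k + 1)%:~R * u[%classic.
  move=> kn; apply/seteqP; split=> x /=; rewrite in_itv/=.
    move=> xn; have <- : Num.floor (x / u) = k.
      by apply: (pcan_inj (@choice.pickleK int)); rewrite xn.
    by rewrite -ler_pdivlMr// -ltr_pdivrMr// floor_le floorD1_gt.
  rewrite -ler_pdivlMr// -ltr_pdivrMr// => xk.
  by rewrite /B/= -kn; congr choice.pickle; exact: floor_def.
have B0 n : (forall k : int, choice.pickle k <> n) -> B n = set0.
  by move=> h; apply/seteqP; split=> x //=; exact: h.
have mB n : measurable (B n).
  have [[k /BE ->]|/forallNP h] := pselect (exists k : int, choice.pickle k = n).
    exact: measurable_itv.
  by rewrite B0.
pose E := [set w | `|X i0 w + W w| <= u].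
have mE : measurable E.
  rewrite -[E]setTI; apply: (@measurable_fun_le _ _ _ _ _ (cst u)) => //.
  apply: measurableT_comp; first exact: normr_measurable.
  exact: measurable_funD.
have mG n : measurable (W @^-1` B n) by rewrite -[X in measurable X]setTI; exact: mW'.
have step n : (P (E `&` W @^-1` B n) <= (K * (3 * u))%:E * P (W @^-1` B n))%E.
  have [[k /BE Bk]|/forallNP /B0 ->] := pselect (exists k : int, choice.pickle k = n); last first.
    by rewrite preimage_set0 setI0 measure0 mule0.
  (* The length [3 * u] is [2 * u] from the ball plus [u] from the cell. *)
  set J := `[- u - (k + 1)%:~R * u, u - k%:~R * u]%classic.
  have mJ : measurable J by exact: measurable_itv.
  have sub : E `&` W @^-1` B n `<=` W @^-1` B n `&` X i0 @^-1` J.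
    rewrite Bk => w [/= Ew]; rewrite /J !in_itv/= => /andP[h1 h2].
    split; first by rewrite h1.
    move: Ew; rewrite /E/= ler_norml => /andP[h3 h4].
    by rewrite in_itv/=; apply/andP; split; lra.
  apply: (@le_trans _ _ (P (W @^-1` B n `&` X i0 @^-1` J))).
    apply: le_measure => //; rewrite inE; apply: measurableI => //.
    exact: measurable_funPTI.
  rewrite indep_sigma_avoiding//; last first.
    by have := mW _ _ (mB n); rewrite setTI; exact.
  rewrite muleC lee_wpmul2r//.
  have -> : 3 * u = (u - k%:~R * u) - (- u - (k + 1)%:~R * u).
    by rewrite intrD; lra.
  by apply: hK; rewrite intrD; lra.
have Ecov : E `<=` \bigcup_n (E `&` W @^-1` B n).
  by move=> w Ew; exists (choice.pickle (Num.floor (W w / u))).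
apply: (le_trans (measure_sigma_subadditive P _ mE Ecov)).
  by move=> n; exact: measurableI.
apply: (@le_trans _ _ (\sum_(n <oo) (K * (3 * u))%:E * P (W @^-1` B n))%E).
  by apply: lee_nneseries => // n _; exact: step.
rewrite nneseriesZl//.
have tG : trivIset setT (fun n => W @^-1` B n).
  apply/trivIsetP => a b _ _ ab; apply/seteqP; split=> w //= [aE bE].
  by rewrite -aE -bE eqxx in ab.
have -> : (\sum_(n <oo) P (W @^-1` B n) = P (\bigcup_n W @^-1` B n))%E.
  by rewrite measure_bigcup//; apply: eq_eseriesl => k; rewrite in_setT.
rewrite (_ : \bigcup_n _ = setT); first by rewrite probability_setT mule1.
by apply/seteqP; split=> w //= _; exists (choice.pickle (Num.floor (W w / u))).
Qed.

End Independence.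

(** * Measurability of complex-valued functions *)

Section RingClosedFamilies.
Variables (T : Type) (S : comNzRingType) (M : (T -> S) -> Prop).
Hypotheses (Mcst : forall c, M (cst c))
  (MD : forall f g, M f -> M g -> M (f \+ g))
  (MM : forall f g, M f -> M g -> M (f \* g)).

Lemma closed_sum I (r : seq I) (p : pred I) (f : I -> T -> S) :
  (forall i, M (f i)) -> M (fun w => \sum_(i <- r | p i) f i w).
Proof.
move=> Mf; elim: r => [|i r ih].
  by under eq_fun do rewrite big_nil; exact: Mcst.
under eq_fun do rewrite big_cons; case: (p i) => //; exact: MD.
Qed.

Lemma closed_prod I (r : seq I) (p : pred I) (f : I -> T -> S) :
  (forall i, M (f i)) -> M (fun w => \prod_(i <- r | p i) f i w).
Proof.
move=> Mf; elim: r => [|i r ih].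
  by under eq_fun do rewrite big_nil; exact: Mcst.
under eq_fun do rewrite big_cons; case: (p i) => //; exact: MM.
Qed.

(** Leibniz expansion. [M] is abstract so as to cover both measurable complex functions and
    polynomials with measurable coefficients. *)
Lemma closed_det n (A : T -> 'M[S]_n) :
  (forall i j, M (fun w => A w i j)) -> M (fun w => \det (A w)).
Proof.
move=> MA; apply: closed_sum => s.
by apply: (@MM (cst _)) => //; exact: closed_prod.
Qed.

Lemma closed_cofactor n (A : T -> 'M[S]_n) i j :
  (forall i j, M (fun w => A w i j)) -> M (fun w => cofactor (A w) i j).
Proof.
move=> MA; apply: (@MM (cst _)) => //; apply: closed_det => k l.
by under eq_fun do rewrite !mxE.
Qed.

End RingClosedFamilies.

Lemma measurable_fun_invr d (T : measurableType d) (R : realType) (f : T -> R) :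
  measurable_fun setT f -> measurable_fun setT (fun w => (f w)^-1).
Proof.
(* [powR] with exponent -1 is the inverse only on nonnegative reals, hence the detour through the
   square; at a zero of [f] both sides are 0. *)
move=> mf; have -> : (fun w => (f w)^-1) = f \* ((@powR R ^~ (-1)) \o (f \* f)).
  apply/funext => w /=; rewrite powR_inv1 -?expr2 ?sqr_ge0//.
  have [->|f0] := eqVneq (f w) 0; first by rewrite mul0r invr0.
  by rewrite expr2 invfM mulrA divff// mul1r.
apply: measurable_funM => //; apply: measurableT_comp; first exact: measurable_powR.
exact: measurable_funM.
Qed.

Section ComplexMeasurability.
Context d (T : measurableType d) (R : realType).

Definition cmeasurable (f : T -> R[i]) :=
  measurable_fun setT (fun w => complex.Re (f w)) /\
  measurable_fun setT (fun w => complex.Im (f w)).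

Lemma cmeasurable_cst c : cmeasurable (cst c).
Proof. by split; exact: measurable_cst. Qed.

Lemma cmeasurable_real (f : T -> R) :
  measurable_fun setT f -> cmeasurable (fun w => (f w)%:C).
Proof. by move=> mf; split => //; exact: measurable_cst. Qed.

Lemma cmeasurableD f g : cmeasurable f -> cmeasurable g -> cmeasurable (f \+ g).
Proof.
move=> [f1 f2] [g1 g2]; split.
  have -> : (fun w => complex.Re ((f \+ g) w)) = (@complex.Re R \o f) \+ (@complex.Re R \o g).
    by apply/funext => w /=; case: (f w) (g w) => [a b] [c e].
  exact: measurable_funD.
have -> : (fun w => complex.Im ((f \+ g) w)) = (@complex.Im R \o f) \+ (@complex.Im R \o g).
  by apply/funext => w /=; case: (f w) (g w) => [a b] [c e].
exact: measurable_funD.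
Qed.

Lemma cmeasurableM f g : cmeasurable f -> cmeasurable g -> cmeasurable (f \* g).
Proof.
move=> [f1 f2] [g1 g2]; split.
  have -> : (fun w => complex.Re ((f \* g) w)) =
      ((@complex.Re R \o f) \* (@complex.Re R \o g)) \- ((@complex.Im R \o f) \* (@complex.Im R \o g)).
    by apply/funext => w /=; case: (f w) (g w) => [a b] [c e].
  by apply: measurable_funB; exact: measurable_funM.
have -> : (fun w => complex.Im ((f \* g) w)) =
    ((@complex.Re R \o f) \* (@complex.Im R \o g)) \+ ((@complex.Im R \o f) \* (@complex.Re R \o g)).
  by apply/funext => w /=; case: (f w) (g w) => [a b] [c e].
by apply: measurable_funD; exact: measurable_funM.
Qed.

Lemma cmeasurableV f : cmeasurable f -> cmeasurable (fun w => (f w)^-1).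
Proof.
move=> [f1 f2]; pose q w := (complex.Re (f w) ^+ 2 + complex.Im (f w) ^+ 2)^-1.
have mq : measurable_fun setT q.
  by apply: measurable_fun_invr; apply: measurable_funD; exact: measurable_funX.
split.
  have -> : (fun w => complex.Re (f w)^-1) = (@complex.Re R \o f) \* q.
    by apply/funext => w; rewrite /q/=; case: (f w).
  exact: measurable_funM.
have -> : (fun w => complex.Im (f w)^-1) = \- ((@complex.Im R \o f) \* q).
  by apply/funext => w; rewrite /q/=; case: (f w).
by apply: measurable_funN; exact: measurable_funM.
Qed.

Lemma cmeasurable_conj f : cmeasurable f -> cmeasurable (fun w => Num.conj (f w)).
Proof.
move=> [f1 f2]; split.
  have -> : (fun w => complex.Re (Num.conj (f w))) = @complex.Re R \o f.
    by apply/funext => w /=; case: (f w).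
  by [].
have -> : (fun w => complex.Im (Num.conj (f w))) = \- (@complex.Im R \o f).
  by apply/funext => w /=; case: (f w).
exact: measurable_funN.
Qed.

Lemma measurable_cgt0 f : cmeasurable f -> measurable [set w | 0 < f w].
Proof.
move=> [f1 f2].
(* In the partial order of [R[i]], positivity includes the vanishing of the imaginary part. *)
have -> : [set w | 0 < f w] =
    (fun w => complex.Im (f w)) @^-1` [set 0] `&` (fun w => complex.Re (f w)) @^-1` `]0, +oo[%classic.
  apply/seteqP; split => w; rewrite /= ltcE/= in_itv/= andbT.
    by move=> /andP[/eqP].
  by move=> [-> ->]; rewrite eqxx.
by apply: measurableI; rewrite -[X in measurable X]setTI; [exact: f2|exact: f1].
Qed.

Lemma measurable_ceq0 f : cmeasurable f -> measurable [set w | f w = 0].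
Proof.
move=> [f1 f2].
have -> : [set w | f w = 0] =
    (fun w => complex.Im (f w)) @^-1` [set 0] `&` (fun w => complex.Re (f w)) @^-1` [set 0].
  apply/seteqP; split => w /=; first by move=> ->.
  by case: (f w) => a b /= [-> ->].
by apply: measurableI; rewrite -[X in measurable X]setTI; [exact: f2|exact: f1].
Qed.

(* Characteristic polynomials are determinants over a polynomial ring, so
   measurability is propagated coefficientwise. *)
Lemma cmeasurable_char_poly n (A : T -> 'M[R[i]]_n) k :
  (forall i j, cmeasurable (fun w => A w i j)) ->
  cmeasurable (fun w => (char_poly (A w))`_k).
Proof.
move=> mA; pose M (p : T -> {poly R[i]}) := forall k, cmeasurable (fun w => (p w)`_k).
suff : M (fun w => char_poly (A w)) by exact.
apply: closed_det => [p l|f g mf mg l|f g mf mg l|i j l].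
- exact: (cmeasurable_cst p`_l).
- by under eq_fun do rewrite /= coefD; exact: cmeasurableD.
- under eq_fun do rewrite /= coefM.
  apply: closed_sum => [c|f' g'|m]; [exact: cmeasurable_cst|exact: cmeasurableD|].
  exact: cmeasurableM.
under eq_fun do rewrite !mxE coefB coefC.
apply: (cmeasurableD (f := cst _)); first exact: cmeasurable_cst.
under eq_fun do rewrite -mulN1r.
apply: (cmeasurableM (f := cst _)); first exact: cmeasurable_cst.
by case: (l == 0%N); [exact: mA|exact: cmeasurable_cst].
Qed.

End ComplexMeasurability.

(** * Gram matrices and singular values *)

Lemma size_index_enum_ord n : size (index_enum 'I_n) = n.
Proof. by rewrite /index_enum unlock -enumT size_enum_ord. Qed.

Section SimilarDiagonal.
Variables (F : fieldType) (n : nat).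

Lemma char_poly_conj (U D : 'M[F]_n) :
  U \in unitmx -> char_poly (invmx U *m D *m U) = char_poly D.
Proof.
move=> uU; rewrite /char_poly /char_poly_mx.
have -> : 'X%:M - map_mx polyC (invmx U *m D *m U) =
    map_mx polyC (invmx U) *m ('X%:M - map_mx polyC D) *m map_mx polyC U.
  rewrite mulmxBr mulmxBl !map_mxM; congr (_ - _).
  by rewrite scalar_mxC -mulmxA -map_mxM mulVmx// map_mx1 mulmx1.
by rewrite !det_mulmx mulrAC -det_mulmx -map_mxM mulVmx// map_mx1 det1 mul1r.
Qed.

Lemma char_poly_diag (d : 'rV[F]_n) :
  char_poly (diag_mx d) = \prod_i ('X - (d 0 i)%:P).
Proof.
rewrite char_poly_trig ?diag_mx_is_trig//.
by apply: eq_bigr => i _; rewrite !mxE eqxx mulr1n.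
Qed.

End SimilarDiagonal.

Section PositiveCoefficients.
Variable C : numDomainType.

Lemma coef_prod_XaddC_gt0 (I : Type) (r : seq I) (f : I -> C) k :
  (forall i, 0 < f i) -> (k <= size r)%N -> 0 < (\prod_(i <- r) ('X + (f i)%:P))`_k.
Proof.
move=> f0; elim: r k => [|i r ih] k /=.
  by rewrite leqn0 => /eqP ->; rewrite big_nil coef1.
have ge0 j : 0 <= (\prod_(i <- r) ('X + (f i)%:P))`_j.
  have [/ih/ltW//|jr] := leqP j (size r).
  rewrite nth_default//; apply: leq_trans jr; under eq_bigr => l _ do rewrite -[f l]opprK polyCN.
  by rewrite size_prod_XsubC.
rewrite big_cons mulrDl coefD coefXM coefCM => kr.
case: k kr => [_|k kr] /=; first by rewrite add0r mulr_gt0// ih.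
by rewrite ltr_pwDl ?ih// mulr_ge0// ltW.
Qed.

Lemma horner_gt0 (p : {poly C}) x :
  (forall k, (k < size p)%N -> 0 < p`_k) -> p != 0 -> 0 <= x -> 0 < p.[x].
Proof.
rewrite -size_poly_gt0 horner_coef; case: (size p) => // m p0 _ x0.
rewrite big_ord_recl/= expr0 mulr1 ltr_pwDl ?p0//.
by apply: sumr_ge0 => i _; rewrite mulr_ge0 ?exprn_ge0// ltW// p0// /bump/= add1n ltnS.
Qed.

End PositiveCoefficients.

Section GramSpectrum.
Local Open Scope sesquilinear_scope.
Variables (C : numClosedFieldType) (n : nat) (A : 'M[C]_n).
Let H := A *m A ^t*.
Let U := spectralmx H.
Let d := spectral_diag H.

Lemma gram_spectralE : H = invmx U *m diag_mx d *m U.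
Proof. exact/orthomx_spectralP/gram_normalmx. Qed.

Lemma char_poly_sqrtmx_gram :
  char_poly (sqrtmx H) = \prod_i ('X - (sqrtC (d 0 i))%:P).
Proof.
rewrite /sqrtmx -/U -/d -invmx_unitary ?spectral_unitarymx//.
rewrite char_poly_conj ?spectral_unit// char_poly_diag.
by apply: eq_bigr => i _; rewrite mxE.
Qed.

Lemma perm_eigenvalues_sqrtmx :
  perm_eq (eigenvalues (sqrtmx H)) [seq sqrtC (d 0 i) | i <- index_enum 'I_n].
Proof.
apply: prod_XsubC_eq.
by rewrite -eigenvaluesE char_poly_sqrtmx_gram big_map.
Qed.

(** [c%:M - H] is diagonal in the same basis as [H]. With this sign, eigenvalues of [H] above [c]
    give factors with positive constant terms. *)
Lemma char_poly_sub_gram (c : C) :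
  char_poly (c%:M - H) = \prod_i ('X + (d 0 i - c)%:P).
Proof.
have -> : c%:M - H = invmx U *m diag_mx (\row_i (c - d 0 i)) *m U.
  have -> : diag_mx (\row_i (c - d 0 i)) = c%:M - diag_mx d.
    by apply/matrixP => i j; rewrite !mxE; case: eqP => //= _; rewrite ?mulr1n // !mulr0n subr0.
  rewrite mulmxBr mulmxBl scalar_mxC -(mulmxA c%:M) mulVmx ?spectral_unit// mulmx1.
  by rewrite -gram_spectralE.
rewrite char_poly_conj ?spectral_unit// char_poly_diag.
by apply: eq_bigr => i _; rewrite mxE -polyCN opprB.
Qed.

Lemma det_gram : \det H = \prod_i d 0 i.
Proof.
rewrite gram_spectralE !det_mulmx mulrAC -det_mulmx mulVmx ?spectral_unit//.
by rewrite det1 mul1r det_diag.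
Qed.

Lemma sum_norm_sqr_row m (v : 'rV[C]_m) :
  \sum_j `|v 0 j| ^+ 2 = (v *m v ^t*) 0 0.
Proof. by rewrite mxE; apply: eq_bigr => j _; rewrite !mxE normCK. Qed.

(** A row [u] of the unitary matrix [U] is a unit left eigenvector of [H], so the squared norm of
    [u A] is [u H u^* = d 0 i]. *)
Lemma gram_eigenvectorP (i : 'I_n) :
  \sum_j `|row i U 0 j| ^+ 2 = 1 /\
  \sum_j `|(row i U *m A) 0 j| ^+ 2 = d 0 i.
Proof.
have uU : U \is unitarymx := spectral_unitarymx H.
have rU : row i U *m (row i U) ^t* = 1%:M.
  apply/rowP => j; rewrite ord1 !mxE /=.
  have /matrixP/(_ i i) := unitarymxP uU; rewrite !mxE eqxx => <-.
  by apply: eq_bigr => k _; rewrite !mxE.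
split; rewrite sum_norm_sqr_row; first by rewrite rU mxE.
rewrite trmx_mul map_mxM /= mulmxA -(mulmxA (row i U)) -/H gram_spectralE.
rewrite -row_mul !mulmxA mulmxV ?unitarymx_unit// mul1mx row_mul row_diag_mx.
by rewrite -!scalemxAl -rowE rU !mxE mulr1.
Qed.

(** If some [d 0 i <= c], then [c - d 0 i] is a nonnegative root, whereas a polynomial with positive
    coefficients is positive on nonnegative reals. The criterion bounds the spectrum without
    choosing eigenvalues, which suits measurability. *)
Lemma char_poly_coef_gt0P (c : C) : c \is Num.real ->
  (forall i, c < d 0 i) <->
  (forall k, (k <= n)%N -> 0 < (char_poly (c%:M - H))`_k).
Proof.
move=> creal; rewrite char_poly_sub_gram; split=> [cd k kn|coef0 i].
  apply: coef_prod_XaddC_gt0 => [i|]; first by rewrite subr_gt0.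
  by rewrite size_index_enum_ord.
have dreal : d 0 i \is Num.real by rewrite realE spectral_diag_gram_ge0.
rewrite real_ltNge//; apply/negP => dc.
set p := \prod_i _ in coef0.
have sp : size p = n.+1.
  rewrite /p; under eq_bigr => l _ do rewrite -[_ - c]opprK polyCN.
  by rewrite size_prod_XsubC size_index_enum_ord.
have := @horner_gt0 _ p (c - d 0 i).
rewrite sp -size_poly_eq0 sp subr_ge0 => /(_ coef0 isT dc).
by rewrite /p horner_prod (bigD1 i)//= hornerD hornerX hornerC subrKA subrr mul0r ltxx.
Qed.

End GramSpectrum.

Section SingularValues.
Local Open Scope sesquilinear_scope.
Variables (R : realType) (n : nat) (A : 'M[R[i]]_n.+1).
Let d := spectral_diag (A *m A ^t*).
Let s := singular_value n.+1 A.

Let sqrtd := [seq complex.Re (sqrtC (d 0 i)) | i <- index_enum 'I_n.+1].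

Let perm_singular_values : perm_eq (singular_values A) sqrtd.
Proof.
have := perm_map (@complex.Re R) (perm_eigenvalues_sqrtmx A).
by rewrite -map_comp /singular_values perm_sort.
Qed.

(** The sorted list is nonincreasing and has [n.+1] entries, so its entry at position [n] is the
    minimum. *)
Lemma smallest_singular_valueP :
  exists2 i, s = complex.Re (sqrtC (d 0 i)) &
    forall j, s <= complex.Re (sqrtC (d 0 j)).
Proof.
have s_in : s \in singular_values A.
  by rewrite mem_nth// size_singular_values.
have : s \in sqrtd by rewrite -(perm_mem perm_singular_values).
case/mapP => i _ sE; exists i => // j.
have : complex.Re (sqrtC (d 0 j)) \in singular_values A.
  by rewrite (perm_mem perm_singular_values); apply: map_f; rewrite mem_index_enum.
move/(nthP 0) => [k ks <-]; rewrite /s /singular_value /=.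
have srt : sorted >=%R (singular_values A).
  by apply: sort_sorted => x y; exact: le_total.
apply: (sorted_leq_nth _ _ 0 srt) => //.
- by move=> x y z /= xy yz; exact: le_trans yz xy.
- by move=> x /=.
- by rewrite inE size_singular_values.
- by move: ks; rewrite size_singular_values ltnS.
Qed.

Let Re_sqrtd_ge0 i : 0 <= complex.Re (sqrtC (d 0 i)).
Proof.
have : 0 <= sqrtC (d 0 i) by rewrite sqrtC_ge0 spectral_diag_gram_ge0.
by rewrite lecE => /andP[].
Qed.

Let dE i : d 0 i = (complex.Re (sqrtC (d 0 i)) ^+ 2)%:C.
Proof.
rewrite rmorphXn /= RRe_real ?sqrtCK// realE sqrtC_ge0.
by rewrite spectral_diag_gram_ge0.
Qed.

Lemma smallest_singular_value_gtP (t : R) : 0 <= t ->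
  (t < s) <-> (forall k, (k <= n.+1)%N ->
    0 < (char_poly (((t ^+ 2)%:C)%:M - A *m A ^t*))`_k).
Proof.
move=> t0; rewrite -char_poly_coef_gt0P; last by apply/complex_realP; exists (t ^+ 2).
have [i sE sle] := smallest_singular_valueP.
split=> [ts j|/(_ i)]; rewrite [X in _ < X]dE ltcR ltr_pXn2r// ?nnegrE// -?sE//.
exact: lt_le_trans (sle j).
Qed.

Lemma smallest_singular_value_vector (t : R) : s <= t ->
  exists2 x : 'rV[R[i]]_n.+1, \sum_j `|x 0 j| ^+ 2 = 1 &
    \sum_j `|(x *m A) 0 j| ^+ 2 <= (t ^+ 2)%:C.
Proof.
move=> st; have [i sE sle] := smallest_singular_valueP.
have [x1 xA] := gram_eigenvectorP A i.
exists (row i (spectralmx (A *m A ^t*))) => //.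
rewrite xA [X in X <= _]dE -sE lecR lerXn2r// nnegrE ?sE//.
by apply: le_trans st; rewrite sE.
Qed.

Lemma smallest_singular_value_unitmx : 0 < s -> A \in unitmx.
Proof.
move=> s0; have [i sE sle] := smallest_singular_valueP.
have : \det (A *m A ^t*) != 0.
  rewrite det_gram; apply/prodf_neq0 => j _; rewrite -/d dE.
  by rewrite gt_eqF// ltcR exprn_gt0// (lt_le_trans s0).
by rewrite det_mulmx mulf_eq0 negb_or unitmxE unitfE => /andP[].
Qed.

End SingularValues.

(** * Determinants of arrays *)

Lemma small_row_image_det (R : realType) n (A : 'M[R[i]]_n.+1)
    (x : 'rV[R[i]]_n.+1) (t : R) : 0 <= t ->
  \sum_j `|x 0 j| ^+ 2 = 1 -> \sum_j `|(x *m A) 0 j| ^+ 2 <= (t ^+ 2)%:C ->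
  exists i, forall m, (forall j, `|cofactor A i j| <= m) ->
    `|\det A| <= (t * n.+1%:R ^+ 2)%:C * m.
Proof.
move=> t0 x1 xA; pose N : R[i] := n.+1%:R.
have N0 : 0 < N by rewrite ltr0n.
have N1 : 1 <= N by rewrite ler1n.
(* Otherwise each squared modulus is below [N^-1], because [N^-1 <= 1], and the [N] squares cannot
   sum to 1. *)
have [i xi] : exists i, N^-1 <= `|x 0 i|.
  apply/existsP; apply: contraTT isT => /existsPn xlt.
  have : \sum_j `|x 0 j| ^+ 2 < \sum_(j < n.+1) N^-1.
    apply: ltr_sum => [|j _]; first by apply/hasP; exists ord0; rewrite ?mem_index_enum.
    have xj : `|x 0 j| < N^-1.
      by rewrite real_ltNge ?normr_real ?realV ?realn//; exact: xlt.
    apply: (@lt_le_trans _ _ (N^-1 ^+ 2)).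
      by rewrite ltr_pXn2r ?nnegrE ?invr_ge0 ?(ltW N0).
    by rewrite expr2 ler_piMl ?invr_ge0 ?(ltW N0)// invf_le1.
  by rewrite x1 sumr_const card_ord -mulr_natl divff ?ltxx// gt_eqF.
exists i => m cofm.
have xAj j : `|(x *m A) 0 j| <= t%:C.
  rewrite -(@ler_pXn2r _ 2)// ?nnegrE ?lecR//.
  have -> : t%:C ^+ 2 = (t ^+ 2)%:C by rewrite rmorphXn.
  by apply: le_trans xA; rewrite (bigD1 j)//= lerDl sumr_ge0// => k _; rewrite exprn_ge0.
(* Multiply [x *m A] on the right by the adjugate. *)
have eqx : x 0 i * \det A = \sum_j (x *m A) 0 j * cofactor A i j.
  transitivity ((x *m A *m \adj A) 0 i).
    by rewrite -mulmxA mul_mx_adj mul_mx_scalar mxE mulrC.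
  by rewrite mxE; apply: eq_bigr => j _; rewrite [\adj A j i]mxE.
(* One factor [N] counts the terms of the sum; the other comes from the lower bound on the
   coordinate [x 0 i]. *)
have Nx : N^-1 * `|\det A| <= N * (t%:C * m).
  apply: (@le_trans _ _ `|x 0 i * \det A|); first by rewrite normrM ler_wpM2r.
  rewrite eqx; apply: le_trans (ler_norm_sum _ _ _) _.
  rewrite /N -[X in X%:R * _](card_ord n.+1) mulr_natl -sumr_const ler_sum// => j _.
  by rewrite normrM ler_pM.
have -> : (t * n.+1%:R ^+ 2)%:C * m = N * (N * (t%:C * m)).
  by rewrite rmorphM rmorphXn rmorph_nat -/N; ring.
by rewrite -ler_pdivrMl.
Qed.

Section Arrays.
Variable R : realType.
Implicit Types (x : nat -> nat -> R) (z : R[i]).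

(** Erasing an entry while keeping a full array lets the same functionals be evaluated independently
    of that entry. *)
Definition zero_at x i j : nat -> nat -> R :=
  fun k l => if (k == i) && (l == j) then 0 else x k l.

Lemma zero_at_eq x i j : zero_at x i j i j = 0.
Proof. by rewrite /zero_at !eqxx. Qed.

Definition rowsum x n i : R := \sum_(k < n) x i k.

Lemma rowsum_zero_at x n i j : (j < n)%N ->
  rowsum x n i = x i j + rowsum (zero_at x i j) n i.
Proof.
move=> jn; rewrite /rowsum (bigD1 (Ordinal jn))//= [in RHS](bigD1 (Ordinal jn))//=.
rewrite zero_at_eq add0r; congr (_ + _); apply: eq_bigr => k.
by rewrite -val_eqE /zero_at /= => /negbTE ->; rewrite andbF.
Qed.

Lemma rowsum_zero_at_other x n i j k : k != i ->
  rowsum (zero_at x i j) n k = rowsum x n k.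
Proof. by move=> /negbTE ki; apply: eq_bigr => l _; rewrite /zero_at ki. Qed.

Lemma shifted_markov_mxE x n z (i k : 'I_n) : rowsum x n i != 0 ->
  (rowsum x n i)%:C * shifted_markov_mx x n z i k =
  (Num.sqrt n%:R * x i k)%:C - z * (rowsum x n i)%:C *+ (i == k).
Proof.
move=> S0; rewrite !mxE -/(rowsum x n i) (negbTE S0) mulrBr; congr (_ - _).
  by rewrite -rmorphM mulrCA (mulrC (rowsum _ _ _)) divfK.
by rewrite mulrnAr mulrC.
Qed.

(** The cofactor deletes row [i], and normalisation acts row by row, so nothing from row [i] of [x]
    remains. *)
Lemma cofactor_zero_at x n z (i : 'I_n) j k :
  cofactor (shifted_markov_mx (zero_at x i j) n z) i k =
  cofactor (shifted_markov_mx x n z) i k.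
Proof.
congr (_ * \det _); apply/matrixP => p q; rewrite !mxE.
have li : (lift i p : nat) != i by rewrite val_eqE eq_sym neq_lift.
rewrite -!/(rowsum _ n _) rowsum_zero_at_other// /zero_at.
by rewrite (negbTE li).
Qed.

(* The cofactors of row i are orthogonal to the other rows; clearing the
   denominator of row i turns them into the coefficients of rowsum_det. *)
Definition normal_coef x n z (i k : 'I_n) : R[i] :=
  (Num.sqrt n%:R)%:C * cofactor (shifted_markov_mx x n z) i k
  - z * cofactor (shifted_markov_mx x n z) i i.

Lemma normal_coef_zero_at x n z (i j k : 'I_n) :
  normal_coef (zero_at x i j) z i k = normal_coef x z i k.
Proof. by rewrite /normal_coef !cofactor_zero_at. Qed.

(** The diagonal contribution [z S_i cof_ii], with [S_i] written as the sum of the [x i k],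
    distributes over all columns; hence [z cof_ii] is subtracted in every coefficient. *)
Lemma rowsum_det x n z (i : 'I_n) : rowsum x n i != 0 ->
  (rowsum x n i)%:C * \det (shifted_markov_mx x n z) =
  \sum_(k < n) (x i k)%:C * normal_coef x z i k.
Proof.
move=> S0; rewrite (expand_det_row _ i) mulr_sumr.
under eq_bigr => k _ do rewrite mulrA shifted_markov_mxE// mulrBl.
rewrite sumrB /normal_coef.
under [in RHS]eq_bigr => k _ do rewrite mulrBr.
rewrite sumrB; congr (_ - _).
  by apply: eq_bigr => k _; rewrite rmorphM -mulrA [RHS]mulrCA.
transitivity (z * (rowsum x n i)%:C * cofactor (shifted_markov_mx x n z) i i).
  rewrite (bigD1 i) //= eqxx mulr1n [X in _ + X]big1 ?addr0// => k.
  by rewrite eq_sym => /negbTE ->; rewrite mulr0n mul0r.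
by rewrite -mulr_suml /rowsum rmorph_sum/= mulrAC mulrC.
Qed.

(** Dividing by the [j]-th coefficient gives [x i j] coefficient 1, so evaluation at [zero_at x i j]
    leaves exactly the remainder. The real part is taken because anticoncentration concerns real
    variables. *)
Definition offset x n z (i j : 'I_n) : R :=
  complex.Re ((\sum_(k < n) (x i k)%:C * normal_coef x z i k) / normal_coef x z i j).

Lemma offset_zero_at x n z (i j : 'I_n) : normal_coef x z i j != 0 ->
  offset x z i j = x i j + offset (zero_at x i j) z i j.
Proof.
move=> y0; rewrite /offset normal_coef_zero_at.
under [X in _ + complex.Re (X / _)]eq_bigr => k _ do rewrite normal_coef_zero_at.
rewrite (bigD1 j)//= [X in _ + complex.Re (X / _)](bigD1 j)//=.
rewrite zero_at_eq mul0r add0r mulrDl mulfK// raddfD/=; congr (_ + complex.Re (_ / _)).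
by apply: eq_bigr => k; rewrite -val_eqE /zero_at => /negbTE ->; rewrite andbF.
Qed.

(* The leading m x m block of [sqrt n M - z I] with every row multiplied by the
   corresponding row sum: its entries are linear in x. *)
Definition cleared_mx x n z m : 'M[R[i]]_m :=
  \matrix_(k < m, l < m) ((Num.sqrt n%:R * x k l)%:C
    - z * (rowsum x n k)%:C *+ (k == l)).

Definition cleared_minor x n z m : R[i] := \det (cleared_mx x n z m).

Lemma cleared_minor_det x n z : (forall i, (i < n)%N -> rowsum x n i != 0) ->
  cleared_minor x n z n =
  (\prod_(i < n) (rowsum x n i)%:C) * \det (shifted_markov_mx x n z).
Proof.
move=> S0; pose D := diag_mx (\row_(i < n) (rowsum x n i)%:C).
have -> : \prod_(i < n) (rowsum x n i)%:C = \det D.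
  by rewrite det_diag; apply: eq_bigr => i _; rewrite mxE.
rewrite -det_mulmx; congr (\det _); apply/matrixP => k l.
by rewrite mul_diag_mx !mxE -shifted_markov_mxE ?S0// !mxE.
Qed.

Lemma cleared_minor_zero_at x n z m : (m < n)%N ->
  cleared_minor (zero_at x m m) n z m = cleared_minor x n z m.
Proof.
move=> mn; congr (\det _); apply/matrixP => k l; rewrite !mxE.
have km : (k : nat) != m by rewrite ltn_eqF.
by rewrite rowsum_zero_at_other// /zero_at (negbTE km).
Qed.

(** The entry [x m m] enters only the last diagonal entry, once directly and once through the row
    sum. The minor is therefore affine in it, with slope [sqrt n - z] times the previous minor. *)
Lemma cleared_minorS x n z m : (m < n)%N ->
  cleared_minor x n z m.+1 =
  (x m m)%:C * (((Num.sqrt n%:R)%:C - z) * cleared_minor x n z m)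
  + cleared_minor (zero_at x m m) n z m.+1.
Proof.
move=> mn; rewrite /cleared_minor (expand_det_row _ ord_max).
rewrite [X in _ = _ + X](expand_det_row _ ord_max).
pose B := cleared_mx x n z m.+1; pose B' := cleared_mx (zero_at x m m) n z m.+1.
rewrite -/B -/B'.
have cofE l : cofactor B' ord_max l = cofactor B ord_max l.
  congr (_ * \det _); apply/matrixP => p q; rewrite !mxE.
  have pm : (lift ord_max p : nat) != m.
    by rewrite lift_max ltn_eqF.
  by rewrite rowsum_zero_at_other// /zero_at (negbTE pm).
under [X in _ = _ + X]eq_bigr => l _ do rewrite cofE.
rewrite (bigD1 ord_max)//= [X in _ = _ + X](bigD1 ord_max)//= addrA.
congr (_ + _); last first.
  apply: eq_bigr => l lm; congr (_ * _); rewrite !mxE /zero_at /=.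
  have -> : ((l : nat) == m) = false.
    by apply/negbTE; apply: contraNneq lm => lm; apply/eqP/val_inj.
  by rewrite andbF eq_sym (negbTE lm) !mulr0n !subr0.
rewrite !mxE !eqxx !mulr1n {1}(rowsum_zero_at _ _ mn) zero_at_eq mulr0 sub0r.
have -> : cofactor B ord_max ord_max = cleared_minor x n z m.
  rewrite /cofactor -signr_odd oddD addbb expr0 mul1r; congr (\det _).
  by apply/matrixP => p q; rewrite !mxE !lift_max (inj_eq lift_inj).
have -> (a b c : R) : (a * b)%:C - z * (b + c)%:C =
    b%:C * (a%:C - z) + (0 - z * c%:C).
  by rewrite rmorphM rmorphD; ring.
by rewrite sub0r mulrDl -mulrA.
Qed.

End Arrays.

Lemma exists_max_ord (R : realType) n (f : 'I_n.+1 -> R) :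
  exists j, forall k, f k <= f j.
Proof.
case: (@Order.TotalTheory.arg_maxP _ _ _ (@ord0 n) predT f isT) => j _ jmax.
by exists j => k; exact: jmax.
Qed.

Lemma normc_real (R : realType) (a : R) : `|a%:C| = `|a|%:C.
Proof. by rewrite normc_def /= expr0n addr0 sqrtr_sqr. Qed.

(** Taking [k = i] and using [|s - z| >= s - C >= 1] bounds [c i] by [Y]; the triangle inequality
    then bounds [s * c k] by [(1 + C) * Y]. *)
Lemma norm_le_shifted_scale (F : numDomainType) (I : Type) (s z C Y : F)
    (c : I -> F) (i : I) :
  0 <= C -> `|z| <= C -> C + 1 <= s ->
  (forall k, `|s * c k - z * c i| <= Y) -> forall k, `|c k| <= (1 + C) * Y.
Proof.
move=> C0 zC Cs cY k.
have s_ge1 : 1 <= s by apply: le_trans Cs; rewrite lerDr.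
have s0 : 0 <= s := le_trans ler01 s_ge1.
have ns : `|s| = s by rewrite ger0_norm.
have Y0 : 0 <= Y := le_trans (normr_ge0 _) (cY k).
have ci : `|c i| <= Y.
  apply: le_trans (cY i); rewrite -mulrBl normrM ler_peMl//.
  have : `|s| - `|z| <= `|s - z| by exact: lerB_dist.
  by apply: le_trans; rewrite ns lerBrDr (le_trans _ Cs)// addrC lerD2r.
apply: (@le_trans _ _ (s * `|c k|)); first by rewrite ler_peMl.
rewrite -[X in X * _]ns -normrM.
rewrite -[s * _](subrK (z * c i)) mulrDl mul1r.
apply: le_trans (ler_normD _ _) _; apply: lerD; first exact: cY.
by rewrite normrM ler_pM.
Qed.

(** * From a small singular value to a small ball event *)

Section SmallSingularValue.
Variables (R : realType) (n : nat) (x : nat -> nat -> R) (z : R[i]) (C t e : R).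
Let N := n.+1.
Let A := shifted_markov_mx x N z.
Hypotheses (C0 : 0 <= C) (zC : `|z| <= C%:C) (CN : C + 1 <= Num.sqrt N%:R).

Lemma cofactor_le_normal_coef (i : 'I_N) (Y : R[i]) :
  (forall k, `|normal_coef x z i k| <= Y) ->
  forall k, `|cofactor A i k| <= (1 + C)%:C * Y.
Proof.
move=> yY k; rewrite rmorphD rmorph1.
apply: (@norm_le_shifted_scale _ _ (Num.sqrt N%:R)%:C z C%:C Y _ i) => //.
  by rewrite lecR.
by rewrite -[1](rmorph1 (real_complex R)) -rmorphD lecR.
Qed.

Lemma small_singular_value_offset :
  0 <= t -> (forall i, (i < N)%N -> rowsum x N i != 0) -> \det A != 0 ->
  (forall i j, (i < N)%N -> (j < N)%N -> `|x i j - 1| <= e) ->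
  singular_value N A <= t ->
  exists i j : 'I_N, `|x i j + offset (zero_at x i j) z i j| <=
    (1 + C) * (t * N%:R ^+ 3) * (1 + e).
Proof.
move=> t0 S0 det0 xe st.
have [v v1 vA] := smallest_singular_value_vector st.
have [i iP] := small_row_image_det t0 v1 vA.
pose y k := normal_coef x z i k.
(* The moduli are real elements of the partially ordered [R[i]]; real parts allow a maximum to be
   taken. *)
have [j jmax] := exists_max_ord (fun k => complex.Re `|y k|).
have yE k : `|y k| = (complex.Re `|y k|)%:C by rewrite RRe_real// normr_real.
have ymax k : `|y k| <= `|y j|.
  by have := jmax k; rewrite -lecR -!yE.
have cofY := cofactor_le_normal_coef ymax.
(* A vanishing largest coefficient would annihilate all cofactors of row [i], hence the
   determinant. *)
have yj0 : y j != 0.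
  apply: contra_neq det0 => yj0; apply/eqP; rewrite -normr_le0.
  by apply: le_trans (iP _ cofY) _; rewrite yj0 normr0 !mulr0.
exists i, j; rewrite -(offset_zero_at yj0) /offset -rowsum_det ?S0//.
set q := _ / _.
(* The row sum contributes [N (1 + e)] and the determinant [t N^2 (1 + C) |y j|], which explains the
   cube. *)
have : `|q| <= ((1 + C) * (t * N%:R ^+ 3) * (1 + e))%:C.
  rewrite normrM normfV ler_pdivrMr ?normr_gt0// normrM.
  have Sle : `|(rowsum x N i)%:C| <= (N%:R * (1 + e))%:C.
    rewrite normc_real lecR; apply: le_trans (ler_norm_sum _ _ _) _.
    rewrite -[X in X%:R * _](card_ord N) mulr_natl -sumr_const ler_sum// => k _.
    rewrite -[x i k](subrK 1) addrC (le_trans (ler_normD _ _))// normr1 lerD2l.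
    exact: xe.
  have -> : ((1 + C) * (t * N%:R ^+ 3) * (1 + e))%:C * `|y j| =
      (N%:R * (1 + e))%:C * ((t * N%:R ^+ 2)%:C * ((1 + C)%:C * `|y j|)).
    have -> : (1 + C) * (t * N%:R ^+ 3) * (1 + e) =
        N%:R * (1 + e) * (t * N%:R ^+ 2 * (1 + C)) by ring.
    by rewrite !(rmorphM (real_complex R)) !mulrA.
  by apply: ler_pM => //; exact: iP.
by move=> /(le_trans (normc_ge_Re _)); rewrite lecR.
Qed.

End SmallSingularValue.

(** * Measurability of the functionals of the array *)

Section ArrayMeasurability.
Context d (T : measurableType d) (R : realType) (X : nat -> nat -> T -> R).
Hypothesis mX : forall i j, measurable_fun setT (X i j).
Let x w i j := X i j w.

Lemma measurable_rowsum n i : measurable_fun setT (fun w => rowsum (x w) n i).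
Proof. by apply: measurable_sum => k; exact: mX. Qed.

Lemma cmeasurable_shifted_markov_mx n z (i j : 'I_n) :
  cmeasurable (fun w => shifted_markov_mx (x w) n z i j).
Proof.
under eq_fun do rewrite !mxE.
apply: (cmeasurableD (g := cst _)); last exact: cmeasurable_cst.
apply: cmeasurable_real; apply: measurable_funM; first exact: measurable_cst.
apply: measurable_fun_ifT.
- by apply: measurable_fun_eqr; [exact: measurable_rowsum|exact: measurable_cst].
- exact: measurable_cst.
apply: measurable_funM; first exact: mX.
by apply: measurable_fun_invr; exact: measurable_rowsum.
Qed.

Lemma measurable_smallest_singular_value n z t : 0 <= t ->
  measurable [set w | singular_value n.+1 (shifted_markov_mx (x w) n.+1 z) <= t].
Proof.
move=> t0.
pose p k w := (char_poly (((t ^+ 2)%:C)%:M - shifted_markov_mx (x w) n.+1 z *m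
    map_mx Num.conj (shifted_markov_mx (x w) n.+1 z)^T))`_k.
have -> : [set w | singular_value n.+1 (shifted_markov_mx (x w) n.+1 z) <= t] =
    ~` (\bigcap_(k in [set k | (k <= n.+1)%N]) [set w | 0 < p k w]).
  apply/seteqP; split => w /=.
    by rewrite leNgt => /negP st pk; apply/st/smallest_singular_value_gtP.
  move=> npk; rewrite leNgt; apply/negP => /smallest_singular_value_gtP.
  by move=> /(_ t0) pk; apply: npk => k /=; exact: pk.
apply: measurableC; apply: bigcap_measurable => [|k _]; first by exists 0%N.
apply: measurable_cgt0; apply: cmeasurable_char_poly => i j.
under eq_fun do rewrite !mxE.
apply: (cmeasurableD (f := cst _)); first exact: cmeasurable_cst.
under eq_fun do rewrite -mulN1r.
apply: (cmeasurableM (f := cst _)); first exact: cmeasurable_cst.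
apply: closed_sum => [c|f g|l].
- exact: cmeasurable_cst.
- exact: cmeasurableD.
apply: cmeasurableM; first exact: cmeasurable_shifted_markov_mx.
under eq_fun do rewrite !mxE.
apply: cmeasurable_conj.
by have := cmeasurable_shifted_markov_mx z j l; under eq_fun do rewrite !mxE.
Qed.

Lemma cmeasurable_normal_coef n z (i k : 'I_n) :
  cmeasurable (fun w => normal_coef (x w) z i k).
Proof.
have mcof l : cmeasurable (fun w => cofactor (shifted_markov_mx (x w) n z) i l).
  apply: closed_cofactor => [c|f g|f g|p q].
  - exact: cmeasurable_cst.
  - exact: cmeasurableD.
  - exact: cmeasurableM.
  exact: cmeasurable_shifted_markov_mx.
apply: cmeasurableD.
  by apply: (cmeasurableM (f := cst _)); first exact: cmeasurable_cst.
under eq_fun do rewrite -mulNr.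
by apply: (cmeasurableM (f := cst _)); first exact: cmeasurable_cst.
Qed.

Lemma measurable_offset n z (i j : 'I_n) :
  measurable_fun setT (fun w => offset (x w) z i j).
Proof.
suff [] : cmeasurable (fun w => (\sum_(k < n) (x w i k)%:C * normal_coef (x w) z i k)
    / normal_coef (x w) z i j) by [].
apply: cmeasurableM; last by apply: cmeasurableV; exact: cmeasurable_normal_coef.
apply: closed_sum => [c|f g|k].
- exact: cmeasurable_cst.
- exact: cmeasurableD.
by apply: cmeasurableM; [exact/cmeasurable_real/mX|exact: cmeasurable_normal_coef].
Qed.

Lemma cmeasurable_cleared_minor n z m :
  cmeasurable (fun w => cleared_minor (x w) n z m).
Proof.
apply: closed_det => [c|f g|f g|k l].
- exact: cmeasurable_cst.
- exact: cmeasurableD.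
- exact: cmeasurableM.
under eq_fun do rewrite !mxE.
apply: cmeasurableD.
  by apply: cmeasurable_real; apply: measurable_funM => //; exact: mX.
case: (k == l) => /=.
  under eq_fun do rewrite mulr1n -mulNr.
  apply: (cmeasurableM (f := cst _)); first exact: cmeasurable_cst.
  by apply: cmeasurable_real; exact: measurable_rowsum.
by under eq_fun do rewrite mulr0n; exact: cmeasurable_cst.
Qed.

End ArrayMeasurability.

(** * Small balls and null events *)

Lemma has_bounded_density_itv d (T : measurableType d) (R : realType)
    (P : probability T R) (X : {RV P >-> R}) : has_bounded_density X ->
  exists2 K : R, 0 <= K & forall a b, a <= b ->
    (distribution P X `[a, b] <= (K * (b - a))%:E)%E.
Proof.
move=> [f [mf f0 [K fK] dist]]; have K0 : 0 <= K := le_trans (f0 0) (fK 0).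
exists K => // a b ab; rewrite dist//.
apply: (@le_trans _ _ (\int[lebesgue_measure]_(x in `[a, b]) (cst K%:E x))%E).
  apply: ge0_le_integral => //.
  - by move=> x _; rewrite lee_fin.
  - by apply/measurable_EFinP; exact: measurable_funTS.
  - by move=> x _; rewrite lee_fin.
rewrite integral_cst//; have /= := @lebesgue_measure_itv R `[a, b].
rewrite lte_fin => ->.
(* The second branch is the degenerate interval [a = b], of measure zero. *)
case: ifPn => [_|]; first by rewrite -EFinB -EFinM.
by rewrite mule0 lee_fin mulr_ge0// subr_ge0.
Qed.

Section UnionBound.
Context d (T : measurableType d) (R : realType) (P : probability T R).

Lemma union_bound (I : finType) (A : I -> set T) (c : R) :
  (forall i, measurable (A i)) -> (forall i, (P (A i) <= c%:E)%E) ->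
  (P (\bigcup_i A i) <= (#|I|%:R * c)%:E)%E.
Proof.
move=> mA Ac; have -> : \bigcup_i A i = \big[setU/set0]_(i <- enum I) A i.
  rewrite -bigcup_seq; congr bigcup; apply/seteqP; split=> i //= _.
  by rewrite mem_enum.
rewrite cardE; elim: (enum I) => [|i r ih] /=.
  by rewrite big_nil measure0 mul0r.
have -> : ((size r).+1%:R * c)%:E = (c%:E + ((size r)%:R * c)%:E)%E.
  by rewrite -EFinD -natr1 mulrDl mul1r addrC.
rewrite big_cons.
apply: (le_trans (measureU2 P _ _)) => //; first exact: bigsetU_measurable.
exact: (leeD (Ac i) ih).
Qed.

End UnionBound.

Section RandomArray.
Context d (T : measurableType d) (R : realType) (P : probability T R).
Variable X : nat -> nat -> {RV P >-> R}.
Hypothesis Xindep : mutually_independent (fun ij : nat * nat => X ij.1 ij.2).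
Hypothesis Xident : identically_distributed (fun ij : nat * nat => X ij.1 ij.2).
Variable K : R.
Hypothesis XK : forall a b, a <= b ->
  (distribution P (X 0%N 0%N) `[a, b] <= (K * (b - a))%:E)%E.
Let x w i j := X i j w.

Let mx i j : measurable_fun setT (fun w => x w i j).
Proof. exact: measurable_funPT. Qed.

Let mx0 i j k l : measurable_fun setT (fun w => zero_at (x w) i j k l).
Proof.
by rewrite /zero_at; case: (_ && _); [exact: measurable_cst|exact: mx].
Qed.

Lemma measurable_add_le W i j (u : R) : measurable_fun setT W ->
  measurable [set w | `|X i j w + W w| <= u].
Proof.
move=> mW; rewrite -[X in measurable X]setTI.
apply: (@measurable_fun_le _ _ _ _ _ (cst u)) => //.
by apply: measurableT_comp; [exact: normr_measurable|exact: measurable_funD].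
Qed.

(* The functional F sees the array with its (i, j) entry erased, hence is
   independent of that entry. *)
Lemma small_ball_zero_at (F : (nat -> nat -> R) -> R) i j (u : R) :
  (forall d' (T' : measurableType d') (Y : nat -> nat -> T' -> R),
     (forall k l, measurable_fun setT (Y k l)) ->
     measurable_fun setT (fun w => F (fun k l => Y k l w))) ->
  0 < u ->
  (P [set w | (`|x w i j + F (zero_at (x w) i j)| <= u)%R] <= (K * (3 * u))%:E)%E.
Proof.
move=> mF u0.
apply: (small_ball_sum Xindep (i0 := (i, j))
  (W := fun w => F (zero_at (x w) i j))) => // [a b ab|].
  by rewrite -[X in (X <= _)%E](Xident (0%N, 0%N) (i, j))//; exact: XK.
(* The space here is [T] with the smaller sigma-algebra of the other entries; this is why [mF]
   quantifies over all measurable spaces. *)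
apply: (mF _ (g_sigma_algebraType
  (cylinders_avoiding (fun ij => X ij.1 ij.2) (i, j)))
  (fun k l w => zero_at (x w) i j k l)) => k l.
rewrite /zero_at; have [_|kl] := boolP ((k == i) && (l == j)).
  exact: measurable_cst.
by apply: (measurable_fun_other (X := fun ij => X ij.1 ij.2) (i := (k, l))).
Qed.

(** The event lies in the small ball event of every positive radius. *)
Lemma zero_at_null (F : (nat -> nat -> R) -> R) i j :
  (forall d' (T' : measurableType d') (Y : nat -> nat -> T' -> R),
     (forall k l, measurable_fun setT (Y k l)) ->
     measurable_fun setT (fun w => F (fun k l => Y k l w))) ->
  P [set w | x w i j + F (zero_at (x w) i j) = 0] = 0%E.
Proof.
move=> mF; apply/eqP; rewrite eq_le measure_ge0 andbT.
have mFx : measurable_fun setT (fun w => F (zero_at (x w) i j)).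
  by apply: mF => k l; exact: mx0.
suff small (e : R) : 0 < e ->
    (P [set w | (x w i j + F (zero_at (x w) i j) = 0)%R] <= e%:E)%E.
  by apply/lee_addgt0Pr => e e0; rewrite add0e; exact: small.
move=> e0.
have K0 : 0 <= K.
  rewrite -lee_fin -[K]mulr1 -[X in K * X]subr0.
  by apply: le_trans (XK ler01); exact: measure_ge0.
(* This radius makes the bound [e * (K / (K + 1))], at most [e]; adding 1 covers [K = 0]. *)
have u0 : 0 < e / (3 * (K + 1)) by rewrite divr_gt0// mulr_gt0// ltr_wpDl.
apply: (@le_trans _ _ (K * (3 * (e / (3 * (K + 1)))))%:E).
  apply: le_trans (small_ball_zero_at i j mF u0); apply: le_measure.
  - rewrite inE -[X in measurable X]setTI.
    have : measurable_fun setT (fun w => x w i j + F (zero_at (x w) i j)).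
      exact: measurable_funD.
    by move/(_ measurableT [set 0]); apply.
  - by rewrite inE; exact: measurable_add_le.
  by move=> w /= ->; rewrite normr0 ltW.
rewrite lee_fin (_ : _ * _ = e * (K / (K + 1))); last by field; lra.
by rewrite ler_piMr ?(ltW e0)// ler_pdivrMr ?ltr_wpDl// mul1r lerDl.
Qed.

Lemma rowsum_eq0_null n i : (0 < n)%N -> P [set w | rowsum (x w) n i = 0] = 0%E.
Proof.
move=> n0; rewrite -[RHS](@zero_at_null (fun y => rowsum y n i) i 0%N).
  by congr (P _); apply/seteqP; split => w /=; rewrite (rowsum_zero_at (x w) i n0).
by move=> d' T' Y mY; exact: measurable_rowsum.
Qed.

(** Induction on [m] from the empty determinant 1: when the previous minor is nonzero, the next one
    is affine in [x m m] with nonzero slope, so its vanishing pins [x m m] to a value determined by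
    the other entries. *)
Lemma cleared_minor_eq0_null n z m : (Num.sqrt n%:R)%:C != z -> (m <= n)%N ->
  P [set w | cleared_minor (x w) n z m = 0] = 0%E.
Proof.
move=> nz; elim: m => [_|m ih mn].
  rewrite (_ : [set _ | _] = set0) ?measure0//; apply/seteqP; split=> w //=.
  by rewrite /cleared_minor det_mx00 => /eqP; rewrite oner_eq0.
have mD k : measurable [set w | cleared_minor (x w) n z k = 0].
  by apply: measurable_ceq0; exact: cmeasurable_cleared_minor.
(* Real part of intercept over slope, once evaluated with the entry [(m, m)] erased. *)
pose F y := complex.Re (cleared_minor y n z m.+1 /
  (((Num.sqrt n%:R)%:C - z) * cleared_minor y n z m)).
have mF d' (T' : measurableType d') (Y : nat -> nat -> T' -> R) :
    (forall k l, measurable_fun setT (Y k l)) ->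
    measurable_fun setT (fun w => F (fun k l => Y k l w)).
  move=> mY; suff [] : cmeasurable (fun w => cleared_minor (fun k l => Y k l w) n z m.+1 /
    (((Num.sqrt n%:R)%:C - z) * cleared_minor (fun k l => Y k l w) n z m)) by [].
  apply: cmeasurableM; first exact: cmeasurable_cleared_minor.
  apply: cmeasurableV; apply: (cmeasurableM (f := cst _)).
    exact: cmeasurable_cst.
  exact: cmeasurable_cleared_minor.
apply: (measure_negligible (mD _)).
apply: (@negligibleS _ _ _ _ ([set w | cleared_minor (x w) n z m = 0] `|`
    [set w | x w m m + F (zero_at (x w) m m) = 0])).
  move=> w /= D0; have [->|Dm] := eqVneq (cleared_minor (x w) n z m) 0; [by left|right].
  have c0 : ((Num.sqrt n%:R)%:C - z) * cleared_minor (x w) n z m != 0.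
    by rewrite mulf_neq0// subr_eq0.
  move: D0; rewrite cleared_minorS// => /(congr1 (fun y => complex.Re (y /
    (((Num.sqrt n%:R)%:C - z) * cleared_minor (x w) n z m)))).
  by rewrite mulrDl mulfK// mul0r /F cleared_minor_zero_at// raddfD.
apply: negligibleU; apply/negligibleP => //.
- exact: ih (ltnW mn).
- rewrite -[X in measurable X]setTI.
  have : measurable_fun setT (fun w => x w m m + F (zero_at (x w) m m)).
    by apply: measurable_funD => //; apply: mF => k l; exact: mx0.
  by move/(_ measurableT [set 0]); apply.
exact: zero_at_null.
Qed.

End RandomArray.

(** * Tail bound with free parameters *)

Section SmallestSingularValueTail.
Context d (T : measurableType d) (R : realType) (P : probability T R).
Variable X : nat -> nat -> {RV P >-> R}.
Hypothesis Xindep : mutually_independent (fun ij : nat * nat => X ij.1 ij.2).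
Hypothesis Xident : identically_distributed (fun ij : nat * nat => X ij.1 ij.2).
Hypothesis Xmean : ('E_P[X 0%N 0%N] = 1)%E.
Hypothesis Xvar : ('V_P[X 0%N 0%N] < +oo)%E.
Variable K : R.
Hypothesis XK : forall a b, a <= b ->
  (distribution P (X 0%N 0%N) `[a, b] <= (K * (b - a))%:E)%E.
Let x w i j := X i j w.
Let V := fine ('V_P[X 0%N 0%N]).

Let mx i j : measurable_fun setT (fun w => x w i j).
Proof. exact: measurable_funPT. Qed.

Let mx0 i j k l : measurable_fun setT (fun w => zero_at (x w) i j k l).
Proof.
by rewrite /zero_at; case: (_ && _); [exact: measurable_cst|exact: mx].
Qed.

Let deviation e := [set y : R | e <= `|y - 1|].

Let measurable_deviation e : measurable (deviation e).
Proof.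
rewrite -[X in measurable X]setTI; apply: (@measurable_fun_le _ _ _ _ (cst e)) => //.
apply: measurableT_comp; first exact: normr_measurable.
by apply: measurable_funB; [exact: measurable_id|exact: measurable_cst].
Qed.

Lemma entry_chebyshev e i j : 0 < e ->
  (P (X i j @^-1` deviation e) <= (V / e ^+ 2)%:E)%E.
Proof.
move=> e0; rewrite -[X in (X <= _)%E](Xident (0%N, 0%N) (i, j))//.
have := chebyshev (X 0%N 0%N) e0; rewrite Xmean /= => h.
apply: le_trans h _; rewrite EFinM muleC fineK// ge0_fin_numE//.
exact: variance_ge0.
Qed.

(** Vanishing row sums or determinant are null events. Each of the [N ^ 2] positions then costs a
    Chebyshev term for a large entry and a small ball term of radius [u]. *)
Lemma smallest_singular_value_tail n z (C t e : R) (N := n.+1) :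
  0 <= C -> `|z| <= C%:C -> C + 1 <= Num.sqrt N%:R -> 0 < t -> 0 < e ->
  (P [set w | (singular_value N (shifted_markov_mx (x w) N z) <= t)%R] <=
   (N%:R ^+ 2 * (V / e ^+ 2 + K * (3 * ((1 + C) * (t * N%:R ^+ 3) * (1 + e)))))%:E)%E.
Proof.
move=> C0 zC CN t0 e0; set u := (1 + C) * _ * _.
have u0 : 0 < u by rewrite !mulr_gt0 ?exprn_gt0 ?ltr0n// ltr_pwDl// ltW.
have nz : (Num.sqrt N%:R)%:C != z.
  apply: contraTneq zC => <-; rewrite normc_real lecR ger0_norm ?sqrtr_ge0//.
  by rewrite -ltNge (lt_le_trans _ CN)// ltrDl.
pose S0 (i : 'I_N) := [set w | rowsum (x w) N i = 0].
pose D0 := [set w | cleared_minor (x w) N z N = 0].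
pose dev (ij : 'I_N * 'I_N) := X ij.1 ij.2 @^-1` deviation e.
pose sb (ij : 'I_N * 'I_N) := [set w | `|x w ij.1 ij.2 +
  offset (zero_at (x w) ij.1 ij.2) z ij.1 ij.2| <= u].
have mS0 i : measurable (S0 i).
  rewrite -[X in measurable X]setTI.
  by have /(_ measurableT [set 0]) := measurable_rowsum mx N i; apply.
have mD0 : measurable D0.
  by apply: measurable_ceq0; exact: cmeasurable_cleared_minor.
have mdev ij : measurable (dev ij).
  exact: (measurable_funPTI (X ij.1 ij.2) (measurable_deviation e)).
have msb ij : measurable (sb ij).
  by apply: measurable_add_le; apply: measurable_offset => k l; exact: mx0.
have PS0 : P (\bigcup_i S0 i) = 0%E.
  apply/eqP; rewrite eq_le measure_ge0 andbT -[X in (_ <= X)%E](_ : (#|'I_N|%:R * 0)%:E = 0%E).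
    apply: union_bound => // i.
    by rewrite (rowsum_eq0_null Xindep Xident XK).
  by rewrite mulr0.
have PD0 : P D0 = 0%E by exact: (cleared_minor_eq0_null Xindep Xident XK).
have mS : measurable (\bigcup_i S0 i).
  by apply: fin_bigcup_measurable => //; exact: finite_finset.
have mZ : measurable (\bigcup_i S0 i `|` D0) by exact: measurableU.
have PZ : P (\bigcup_i S0 i `|` D0) = 0%E by exact: null_set_setU.
have mB ij : measurable (dev ij `|` sb ij) by exact: measurableU.
have mBU : measurable (\bigcup_ij (dev ij `|` sb ij)).
  by apply: fin_bigcup_measurable => //; exact: finite_finset.
(* Outside all the bad events the deterministic bound would produce a small ball event, a
   contradiction. *)
have cover : [set w | singular_value N (shifted_markov_mx (x w) N z) <= t] `<=`
    (\bigcup_i S0 i `|` D0) `|` \bigcup_ij (dev ij `|` sb ij).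
  move=> w /= st; apply: contrapT => /not_orP[/not_orP[nS nD] nB].
  have Sw i : (i < N)%N -> rowsum (x w) N i != 0.
    by move=> iN; apply/eqP => Si; apply: nS; exists (Ordinal iN).
  have det0 : \det (shifted_markov_mx (x w) N z) != 0.
    apply/eqP => dw; apply: nD.
    by rewrite /D0/= cleared_minor_det// dw mulr0.
  have xe i j : (i < N)%N -> (j < N)%N -> `|x w i j - 1| <= e.
    move=> iN jN; rewrite leNgt; apply/negP => /ltW ex; apply: nB.
    by exists (Ordinal iN, Ordinal jN) => //; left.
  have [i [j ij]] := small_singular_value_offset C0 zC CN (ltW t0) Sw det0 xe st.
  by apply: nB; exists (i, j) => //; right.
apply: (@le_trans _ _ (P ((\bigcup_i S0 i `|` D0) `|` \bigcup_ij (dev ij `|` sb ij)))).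
  apply: le_measure => //; rewrite inE; last exact: measurableU.
  exact: (measurable_smallest_singular_value mx n z (ltW t0)).
have PU : (P ((\bigcup_i S0 i `|` D0) `|` \bigcup_ij (dev ij `|` sb ij)) <=
    P (\bigcup_i S0 i `|` D0) + P (\bigcup_ij (dev ij `|` sb ij)))%E.
  exact: measureU2.
apply: (le_trans PU).
rewrite PZ add0e (_ : N%:R ^+ 2 = #|{: 'I_N * 'I_N}|%:R); last first.
  by rewrite card_prod card_ord natrM expr2.
apply: union_bound => // ij.
apply: (le_trans (measureU2 P (mdev ij) (msb ij))); rewrite EFinD; apply: leeD.
  exact: entry_chebyshev.
apply: (small_ball_zero_at Xindep Xident XK
  (F := fun y => offset y z ij.1 ij.2)) => // d' T' Y mY.
exact: measurable_offset.
Qed.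

End SmallestSingularValueTail.

(** * Quantitative bounds and Borel-Cantelli *)

(* The bound of smallest_singular_value_tail for n = q, e = q^(k + 2) and
   t = q^-(2 k + 8). *)
Lemma tail_bound_le (R : realType) (V K C q : R) (k : nat) :
  0 <= V -> 0 <= K -> 0 <= C -> 1 <= q -> V + 6 * K * (1 + C) <= q ->
  q ^+ 2 * (V / (q ^+ k * q ^+ 2) ^+ 2 + K * (3 * ((1 + C) *
    ((q ^+ (2 * k + 8))^-1 * q ^+ 3) * (1 + q ^+ k * q ^+ 2)))) <= (q ^+ k)^-1.
Proof.
move=> V0 K0 C0 q1 Vq; set p := q ^+ k.
have p1 : 1 <= p by rewrite exprn_ege1.
have -> : q ^+ (2 * k + 8) = p ^+ 2 * q ^+ 8 by rewrite exprD mulnC exprM.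
have p0 : 0 < p by exact: lt_le_trans p1.
have q0 : 0 < q by exact: lt_le_trans q1.
have -> : q ^+ 2 * (V / (p * q ^+ 2) ^+ 2 + K * (3 * ((1 + C) *
    ((p ^+ 2 * q ^+ 8)^-1 * q ^+ 3) * (1 + p * q ^+ 2)))) =
    (V * q + 3 * K * (1 + C) * (1 + p * q ^+ 2)) / (p ^+ 2 * q ^+ 3).
  by field; rewrite !gt_eqF.
rewrite ler_pdivrMr ?mulr_gt0 ?exprn_gt0// (_ : p^-1 * _ = q * (p * q ^+ 2)); last first.
  by field; rewrite gt_eqF.
have pq : q <= p * q ^+ 2 by nra.
have pq1 : 1 <= p * q ^+ 2 by exact: le_trans pq.
have H0 : 0 <= K * (1 + C) by rewrite mulr_ge0// addr_ge0.
have h1 : V * q <= V * (p * q ^+ 2) by rewrite ler_wpM2l.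
(* As [1 <= p * q ^+ 2], the summand 1 is absorbed by doubling, which turns 3 into 6. *)
have h2 : 3 * K * (1 + C) * (1 + p * q ^+ 2) <= 6 * K * (1 + C) * (p * q ^+ 2).
  by rewrite -!(mulrA _ K); nra.
apply: (le_trans (lerD h1 h2)); rewrite -mulrDl ler_wpM2r//.
by rewrite (le_trans _ pq1).
Qed.

Section BorelCantelli.
Context d (T : measurableType d) (R : realType) (P : probability T R).

Lemma sum_inv_sq_le2 n : \sum_(0 <= i < n) (i.+1%:R ^- 2 : R) <= 2.
Proof.
(* The induction runs on this stronger bound, whose increment [2 / (q (q + 1))] dominates [1 / q^2]
   when [q >= 1]. *)
apply: (@le_trans _ _ (2 - 2 / n.+1%:R)); last first.
  by rewrite gerBl divr_ge0.
elim: n => [|n ih]; first by rewrite big_nil divr1 subrr.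
rewrite big_nat_recr//=; apply: (le_trans (lerD ih (lexx _))).
have n0 : 0 < n.+1%:R :> R by rewrite ltr0n.
rewrite -[n.+2%:R]natr1; move: (n.+1%:R : R) n0 (ler1n R n.+1) => q q0.
rewrite ltn0Sn => q1.
rewrite -subr_ge0 (_ : _ - _ = (q - 1) / (q ^+ 2 * (q + 1))); last first.
  by field; rewrite !gt_eqF// addr_gt0.
by rewrite divr_ge0 ?subr_ge0// mulr_ge0 ?addr_ge0 ?exprn_ge0// ltW.
Qed.

Lemma ae_eventually_notin (F : (set T)^nat) n0 :
  (forall n, (n0 < n)%N -> measurable (F n)) ->
  (forall n, (n0 < n)%N -> (P (F n) <= (n%:R ^- 2)%:E)%E) ->
  {ae P, forall w, \forall n \near \oo, ~ F n w}.
Proof.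
(* The shift starts where the estimates hold and keeps indices positive; [P (G n)] is then at most
   [1 / (n + 1)^2]. *)
move=> mF PF; pose G n := F (n0 + n.+1)%N.
have lt_n0 n : (n0 < n0 + n.+1)%N by rewrite addnS ltnS leq_addr.
have mG n : measurable (G n) by apply: mF.
have sumG : (\sum_(n <oo) P (G n) < +oo)%E.
  apply: (@le_lt_trans _ _ 2%:E); last exact: ltry.
  apply: lime_le; first by apply: is_cvg_nneseries => n _ _; exact: measure_ge0.
  apply: nearW => n; apply: (@le_trans _ _ (\sum_(0 <= i < n) (i.+1%:R ^- 2)%:E)%E).
    apply: lee_sum => i _; apply: (le_trans (PF _ (lt_n0 i))).
    rewrite lee_fin lef_pV2 ?posrE ?exprn_gt0 ?ltr0n ?addnS//.
    by rewrite lerXn2r ?nnegrE// ler_nat ltnS leq_addl.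
  by rewrite sumEFin lee_fin sum_inv_sq_le2.
exists (lim_sup_set G); split.
- by apply: bigcap_measurable => [|k _]; [exists 0%N|exact: bigcup_measurable].
- exact: lim_sup_set_cvg0.
move=> w /= nw m _; apply: contrapT => nG; apply: nw.
exists (n0 + m.+1)%N => //= n /= mn Fn; apply: nG.
exists (n - n0.+1)%N => /=; first by rewrite /= leq_subRL; lia.
by rewrite /G (_ : (n0 + (n - n0.+1).+1)%N = n)//; lia.
Qed.

End BorelCantelli.

Theorem theorem1p4 (d : measure_display) (T : measurableType d) (R : realType)
  (P : probability T R) (X : nat -> nat -> {RV P >-> R})
  (Xindep : mutually_independent (fun ij : nat * nat => X ij.1 ij.2))
  (Xident : identically_distributed (fun ij : nat * nat => X ij.1 ij.2))
  (Xge0 : forall i j : nat, {ae P, forall w, 0 <= X i j w})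
  (Xmean : ('E_P[X 0%N 0%N] = 1)%E)
  (Xvar : (0 < 'V_P[X 0%N 0%N] < +oo)%E)
  (Xdens : has_bounded_density (X 0%N 0%N)) :
  (forall a C : R, 0 < a -> 0 < C ->
     exists2 b : R, 0 < b &
       forall z : R[i], `|z| <= C%:C ->
         \forall n \near \oo,
           (P [set w | (singular_value n
                          (shifted_markov_mx (fun i j => X i j w) n z)
                        <= n%:R `^ (- b))%R]
            <= (n%:R `^ (- a))%:E)%E)
  /\
  (forall C : R, 0 < C ->
     exists2 b : R, 0 < b &
       forall z : R[i], `|z| <= C%:C ->
         {ae P, forall w, \forall n \near \oo,
           shifted_markov_mx (fun i j => X i j w) n z \in unitmx /\
           n%:R `^ (- b) <=
             singular_value n (shifted_markov_mx (fun i j => X i j w) n z)}).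
Proof.
have [K K0 XK] := has_bounded_density_itv Xdens.
have V0 : 0 <= fine ('V_P[X 0%N 0%N]) by rewrite fine_ge0// variance_ge0.
case/andP: Xvar => _ Vfin.
(* An integer exponent [k] serves both claims: [k > a] for the first, [k = 2] for the second. *)
have tail (k : nat) (C : R) (z : R[i]) : 0 < C -> `|z| <= C%:C ->
    \forall n \near \oo, (0 < n)%N /\
      (P [set w | (singular_value n (shifted_markov_mx (fun i j => X i j w) n z)
                   <= n%:R `^ (- (2 * k + 8)%:R))%R]
       <= ((n%:R ^+ k)^-1)%:E)%E.
  move=> C0 zC.
  have bound m : (C + 1) ^+ 2 <= m.+1%:R ->
      fine ('V_P[X 0%N 0%N]) + 6 * K * (1 + C) <= m.+1%:R ->
      (P [set w | (singular_value m.+1 (shifted_markov_mx (fun i j => X i j w) m.+1 z)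
                   <= m.+1%:R `^ (- (2 * k + 8)%:R))%R]
       <= ((m.+1%:R ^+ k)^-1)%:E)%E.
    move=> CN VN; have CsqrtN : C + 1 <= Num.sqrt m.+1%:R.
      by rewrite -(@ger0_norm _ (C + 1)) -?sqrtr_sqr ?ler_wsqrtr// addr_ge0// ltW.
    (* With [e = N^(k+2)] and [t = N^-(2k+8)], where [N] is [m.+1], the Chebyshev part is
       [V N^(-2k-2)] and the small ball part of order [N^(-k-1)]; the spare factor [N] absorbs the
       constants. *)
    have e0 : 0 < m.+1%:R ^+ k * m.+1%:R ^+ 2 :> R by rewrite mulr_gt0 ?exprn_gt0.
    have t0 : 0 < m.+1%:R `^ (- (2 * k + 8)%:R) :> R by rewrite powR_gt0.
    apply: (le_trans (smallest_singular_value_tail Xindep Xident Xmean Vfin XK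
      (ltW C0) zC CsqrtN t0 e0)).
    rewrite lee_fin powRN powR_mulrn//.
    by apply: tail_bound_le => //; [exact: ltW|rewrite ler1n].
  near=> n.
  have n0 : (0 < n)%N by near: n; exact: nbhs_infty_gt.
  split=> //.
  have Cn : (C + 1) ^+ 2 <= n%:R by near: n; exact: nbhs_infty_ger.
  have Vn : fine ('V_P[X 0%N 0%N]) + 6 * K * (1 + C) <= n%:R.
    by near: n; exact: nbhs_infty_ger.
  by rewrite -(prednK n0) in Cn Vn *; exact: bound.
split=> [a C a0 C0|C C0].
  pose k := (Num.truncn a).+1; exists (2 * k + 8)%:R => [|z zC].
    by rewrite ltr0n addn_gt0 orbT.
  apply: filterS (tail k C z C0 zC) => n [n0 /le_trans]; apply.
  rewrite lee_fin powRN lef_pV2 ?posrE ?exprn_gt0 ?powR_gt0 ?ltr0n//.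
  rewrite -powR_mulrn ?ler0n// ler_powR ?ler1n//.
  by rewrite ltW// truncnS_gt.
exists (2 * 2 + 8)%:R => // z zC.
(* With [k = 2] the probabilities are at most [n^-2], which is summable. *)
have [n0 _ tail2] := tail 2%N C z C0 zC.
have := @ae_eventually_notin _ _ _ P (fun n => [set w |
  singular_value n (shifted_markov_mx (fun i j => X i j w) n z)
    <= n%:R `^ (- (2 * 2 + 8)%:R)]) n0.
have mX i j : measurable_fun setT (X i j) by exact: measurable_funPT.
case=> [n n0n|n n0n|].
- case: n n0n => // m _.
  exact: (measurable_smallest_singular_value mX m z (powR_ge0 _ _)).
- by have [] := tail2 n (ltnW n0n).
move=> A [mA PA sub]; exists A; split => // w /= nw; apply: sub => /= ev; apply: nw.
have lower m : ~ singular_value m.+1 (shifted_markov_mx (fun i j => X i j w) m.+1 z)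
      <= m.+1%:R `^ (- (2 * 2 + 8)%:R) ->
    shifted_markov_mx (fun i j => X i j w) m.+1 z \in unitmx /\
    m.+1%:R `^ (- (2 * 2 + 8)%:R) <=
      singular_value m.+1 (shifted_markov_mx (fun i j => X i j w) m.+1 z).
  move/negP; rewrite -ltNge => lt; split; last exact: ltW.
  by apply: smallest_singular_value_unitmx; apply: le_lt_trans lt; exact: powR_ge0.
near=> n; have n0' : (0 < n)%N by near: n; exact: nbhs_infty_gt.
have : ~ singular_value n (shifted_markov_mx (fun i j => X i j w) n z)
    <= n%:R `^ (- (2 * 2 + 8)%:R) by near: n.
by rewrite -(prednK n0'); exact: lower.
Unshelve. all: by end_near.
Qed.
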